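(* For every integer $k\geq 1$, the marked permutation graph $(G_k,M_k)$ contains exactly $6k+6$ $M_k$-copies of the Petersen graph.
   Context: A marked permutation graph is a pair $(G,M)$ where $G$ is a cubic graph and $M$ is a perfect matching of $G$ such that $G-E(M)$ is the disjoint union of two cycles, neither of which has a chord in $G$. An $M$-copy of the Petersen graph $P_{10}$ is a subgraph of $G$ that is isomorphic to a subdivision of $P_{10}$ and is composed of the two cycles of $G-E(M)$ together with five edges of $M$; copies are counted as distinct subgraphs (equivalently, by the set of five edges of $M$ used). The pair $(G_k,M_k)$ is defined as follows. Let $A=\{1,2,\dots,3k+7\}$ and let $A'=\{\overline{1},\overline{2},\dots,\overline{3k+7}\}$ be a disjoint copy of $A$. The vertex set of $G_k$ is $A\cup A'$. The graph $G_k-E(M_k)$ consists of the two cycles $1,2,\dots,3k+7$ (consecutive integers adjacent, and $3k+7$ adjacent to $1$) and $\overline{1},\overline{2},\dots,\overline{3k+7}$ (likewise, with $\overline{3k+7}$ adjacent to $\overline{1}$). The perfect matching $M_k$ has edge set $E_1\cup E_2\cup E_3$, where an edge joining $i\in A$ to $\overline{j}\in A'$ is written $(i)\overline{(j)}$ and $$E_1=\{(2i-1)\overline{(i)} : 1\leq i\leq k\}\cup\{(2k+i+3)\overline{(k+2i+3)} : 1\leq i\leq k\},$$ $$E_2=\{(2i)\overline{(3k+4-2i)} : 1\leq i\leq k-1\},$$ $$E_3=\{(2k)\overline{(k+2)},\ (2k+1)\overline{(k+4)},\ (2k+2)\overline{(k+1)},\ (2k+3)\overline{(k+3)},\ (3k+4)\overline{(3k+5)},\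 (3k+5)\overline{(3k+7)},\ (3k+6)\overline{(3k+4)},\ (3k+7)\overline{(3k+6)}\}.$$ *)

(* Defs.v *)
From HB Require Import structures.
From mathcomp Require Import all_boot.
From mathcomp Require Import boolp.

Set Implicit Arguments.
Unset Strict Implicit.
Unset Printing Implicit Defensive.

(* Finite simple graphs whose vertices are drawn from a finite type [T]: a
   vertex set together with a set of edges, each edge being a 2-element set of
   vertices.  The vertex set need not be all of [T], so that the subgraphs of a
   graph have the same type as the graph itself. *)
Section Graphs.
Variable T : finType.

Definition graph_axiom (D : {set T} * {set {set T}}) : bool :=
  [forall e in D.2, (#|e| == 2) && (e \subset D.1)].

Record sgraph := SGraph {
  graph_data : {set T} * {set {set T}};
  _ : graph_axiom graph_data
}.

HB.instance Definition _ := [isSub for graph_data].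
HB.instance Definition _ := [Finite of sgraph by <:].

Definition vset (G : sgraph) : {set T} := (graph_data G).1.
Definition eset (G : sgraph) : {set {set T}} := (graph_data G).2.

Definition subgraph (H G : sgraph) : bool :=
  (vset H \subset vset G) && (eset H \subset eset G).

Definition degree (G : sgraph) (x : T) : nat := #|[set e in eset G | x \in e]|.

Definition cubic (G : sgraph) : Prop := {in vset G, forall x, degree G x = 3}.

Definition perfect_matching (G : sgraph) (M : {set {set T}}) : Prop :=
  M \subset eset G /\ {in vset G, forall x, #|[set e in M | x \in e]| = 1}.

Lemma del_edges_subproof (G : sgraph) (F : {set {set T}}) :
  graph_axiom (vset G, eset G :\: F).
Proof.
apply/forall_inP => e; rewrite inE => /andP[_ eG].
by have /forall_inP/(_ e eG) := valP G.
Qed.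

Definition del_edges (G : sgraph) (F : {set {set T}}) : sgraph :=
  SGraph (del_edges_subproof G F).

Definition is_cycle (C : sgraph) : Prop :=
  exists s : seq T,
    [/\ 2 < size s, uniq s, vset C = [set:: s]
      & eset C = [set [set x; next s x] | x in s]].

Definition is_disjoint_union (G C D : sgraph) : Prop :=
  [/\ [disjoint vset C & vset D], vset G = vset C :|: vset D
    & eset G = eset C :|: eset D].

Definition is_chord (G C : sgraph) (e : {set T}) : bool :=
  [&& e \in eset G, e \subset vset C & e \notin eset C].

Definition marked_permutation_graph (G : sgraph) (M : {set {set T}}) : Prop :=
  [/\ cubic G, perfect_matching G M
    & exists C D : sgraph,
        [/\ is_cycle C, is_cycle D, is_disjoint_union (del_edges G M) C D
          & forall e, ~~ is_chord G C e && ~~ is_chord G D e]].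

Definition walk_edges (x : T) (s : seq T) : {set {set T}} :=
  [set:: [seq [set a.1; a.2] | a <- zip (x :: s) s]].

End Graphs.

(* [H] is isomorphic to a subdivision of [P]: [f] sends the vertices of [P] to
   the branch vertices of [H], and [p x y] lists, from [f x] to [f y], the
   internal vertices of the path of [H] that replaces the edge [xy] of [P]
   (an empty list when that edge is not subdivided). *)
Definition is_subdivision (S T : finType) (P : sgraph S) (H : sgraph T) : Prop :=
  exists (f : S -> T) (p : S -> S -> seq T),
    [/\ {in vset P &, injective f},
        forall x y, [set x; y] \in eset P ->
          [/\ p y x = rev (p x y), uniq (p x y)
            & {in p x y, forall z, z \notin f @: vset P}],
        forall x y x' y', [set x; y] \in eset P -> [set x'; y'] \in eset P ->
          [set x; y] != [set x'; y'] ->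
          {in p x y, forall z, z \notin p x' y'},
        vset H = (f @: vset P) :|:
          \bigcup_(a : S * S | [set a.1; a.2] \in eset P) [set:: p a.1 a.2]
      & eset H = \bigcup_(a : S * S | [set a.1; a.2] \in eset P)
                   walk_edges (f a.1) (rcons (p a.1 a.2) (f a.2))].

Lemma ordS_neq n (i : 'I_n) : 1 < n -> i != ordS i.
Proof.
move=> n1; rewrite -val_eqE /=.
have [lt_in|] := ltnP i.+1 n; first by rewrite modn_small // neq_ltn ltnSn.
move=> le_ni; have -> : i.+1 = n by apply/eqP; rewrite eqn_leq le_ni ltn_ord.
rewrite modnn; apply: contraTneq le_ni => ->; by rewrite -ltnNge.
Qed.

(* The Petersen graph: an outer 5-cycle on [inl i], an inner pentagram on
   [inr i], and the spokes between them. *)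
Definition petersen_edges : {set {set 'I_5 + 'I_5}} :=
  [set [set inl i; inl (ordS i)] | i : 'I_5]
  :|: [set [set inr i; inr (ordS (ordS i))] | i : 'I_5]
  :|: [set [set inl i; inr i] | i : 'I_5].

Lemma petersen_subproof : graph_axiom ([set: 'I_5 + 'I_5], petersen_edges).
Proof.
apply/forall_inP => e /=; rewrite subsetT andbT !inE.
case/orP=> [/orP[]|] /imsetP[i _ ->]; rewrite cards2 //.
  by rewrite (inj_eq (fun a b => @inl_inj _ _ a b)) ordS_neq.
rewrite (inj_eq (fun a b => @inr_inj _ _ a b)) -val_eqE.
by case: i; do 5?case=> //.
Qed.

Definition petersen : sgraph ('I_5 + 'I_5)%type := SGraph petersen_subproof.

(* [del_edges G M] has all the vertices of [G]; for a marked permutation graph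
   it consists of the two cycles. *)
Definition is_petersen_copy (T : finType) (G : sgraph T) (M : {set {set T}})
    (H : sgraph T) : Prop :=
  [/\ subgraph H G, is_subdivision petersen H
    & exists F : {set {set T}},
        [/\ F \subset M, #|F| = 5, vset H = vset (del_edges G M)
          & eset H = eset (del_edges G M) :|: F]].

Definition petersen_copies (T : finType) (G : sgraph T) (M : {set {set T}}) :
    {set sgraph T} :=
  [set H : sgraph T | `[< is_petersen_copy G M H >]].

Section Family.
Variable k : nat.

Definition ncyc : nat := 3 * k + 7.

(* [inl i] and [inr i] stand for the integer [i + 1] of A and of its copy A'. *)
Definition vertex : finType := ('I_ncyc + 'I_ncyc)%type.

(* The pairs (i, j) below are the edges from i in A to the copy of j in A',
   labelled from 1 to 3k+7; truncated subtraction is harmless for 1 <= k. *)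
Definition E1 : seq (nat * nat) :=
  [seq (2 * i - 1, i) | i <- iota 1 k]
  ++ [seq (2 * k + i + 3, k + 2 * i + 3) | i <- iota 1 k].

Definition E2 : seq (nat * nat) :=
  [seq (2 * i, 3 * k + 4 - 2 * i) | i <- iota 1 (k - 1)].

Definition E3 : seq (nat * nat) :=
  [:: (2 * k, k + 2); (2 * k + 1, k + 4);
      (2 * k + 2, k + 1); (2 * k + 3, k + 3);
      (3 * k + 4, 3 * k + 5); (3 * k + 5, 3 * k + 7);
      (3 * k + 6, 3 * k + 4); (3 * k + 7, 3 * k + 6)].

Definition Mk : {set {set vertex}} :=
  [set [set inl ij.1; inr ij.2]
     | ij : 'I_ncyc * 'I_ncyc & (ij.1.+1, ij.2.+1) \in E1 ++ E2 ++ E3].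

Definition Gk_edges : {set {set vertex}} :=
  [set [set inl i; inl (ordS i)] | i : 'I_ncyc]
  :|: [set [set inr i; inr (ordS i)] | i : 'I_ncyc]
  :|: Mk.

Lemma Gk_subproof : graph_axiom ([set: vertex], Gk_edges).
Proof.
have n1 : 1 < ncyc by rewrite /ncyc addnC.
apply/forall_inP => e /=; rewrite subsetT andbT !inE.
case/orP=> [/orP[]|] /imsetP[i _ ->]; rewrite cards2 //.
  by rewrite (inj_eq (fun a b => @inl_inj _ _ a b)) ordS_neq.
by rewrite (inj_eq (fun a b => @inr_inj _ _ a b)) ordS_neq.
Qed.

Definition Gk : sgraph vertex := SGraph Gk_subproof.

End Family.

(* Main.v *)
Require Import Defs.
From mathcomp Require Import all_boot zify.

Set Implicit Arguments.
Unset Strict Implicit.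
Unset Printing Implicit Defensive.

(** Call two matching edges _consecutive_ on a cycle, with respect to five chosen
    edges, when one of the arcs between their ends holds no end of the others.  Five
    edges complete the two cycles to a subdivision of the Petersen graph exactly when
    no two of them are consecutive on both cycles (lemma [subdivisionP]).

    For the direct implication, the ten ends of the five edges are the vertices of
    degree 3, hence the branch vertices (lemma [branch_degree] and a count), and every
    path between two ends that avoids the other ends comes from an edge of the Petersen
    graph (lemma [branch_path]).  Two edges that are consecutive on both cycles would
    therefore give a 4-cycle, and the Petersen graph has none.  For the converse, number
    the five ends on either cycle in cyclic order.  The edges induce a bijection of
    [Z/5] that sends no edge of the pentagon to an edge of the pentagon; it therefore
    identifies the complementary pentagram with the pentagon, which is how the Petersen
    graph is built.

    In [Gk k] the matching consists of three monotone runs (the rising run, the falling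
    run and the second rising run, called climbing below) and of two blocks of four
    edges, whose ends occupy four neighbouring places of each cycle in the pattern
    2, 4, 1, 3.  A block and any fifth edge satisfy the condition: on the first cycle
    the consecutive pairs are 12, 23, 34, 4x, x1, on the second one 31, 14, 42, 2x, x3.
    Conversely a solution contains a block.  Indeed the relative order of two edges
    depends only on the runs or the places in a block that they come from, except that
    the rising and the falling run alternate on the first cycle and that the falling and
    the climbing run alternate on the second; so only finitely many configurations
    occur, and they are searched exhaustively (lemma [search_labels]).  As five edges
    cannot contain both blocks, the number of copies is twice the number of edges
    outside a given block, that is [2 * (3 * k + 7 - 4) = 6 * k + 6]. *)

Ltac split_ifs :=
  repeat match goal with
  | |- context [if ?b then _ else _] => let h := fresh in case h : b
  end.

(** * Arcs of a cycle on ordinals *)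

Section Arcs.
Variable n : nat.
Implicit Types a b x : 'I_n.

(** The number of steps of [ordS] that lead from [a] to [b]. *)
Definition gap a b : nat := if a <= b then b - a else b + n - a.

(** The vertices met strictly between [a] and [b] when going forward. *)
Definition arc a b : seq 'I_n := traject (@ordS n) (ordS a) (gap a b).-1.

Lemma ordS_val a : ordS a = (if a.+1 < n then a.+1 else 0) :> nat.
Proof.
rewrite /=; case: ltnP => h; first by rewrite modn_small.
by have -> : a.+1 = n by [have := ltn_ord a; lia]; rewrite modnn.
Qed.

Lemma gap_lt a b : gap a b < n.
Proof. by have := ltn_ord a; have := ltn_ord b; rewrite /gap; case: (leqP a b); lia. Qed.

Lemma val_iter_ordS a j :
  j <= n -> iter j (@ordS n) a = (if a + j < n then a + j else a + j - n) :> nat.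
Proof.
have := ltn_ord a.
elim: j => [|j IH] an jn; first by rewrite addn0 an.
rewrite iterS ordS_val IH //; last lia.
by case: (ltnP (a + j) n) => ?; case: ifP => ?; case: ifP; lia.
Qed.

Lemma iter_gap a b : iter (gap a b) (@ordS n) a = b.
Proof.
apply: val_inj; rewrite /= val_iter_ordS; last exact/ltnW/gap_lt.
by have := ltn_ord a; have := ltn_ord b; rewrite /gap; case: (leqP a b) => ? ? ?;
  case: ifP; lia.
Qed.

Lemma gap_iter a j : j < n -> gap a (iter j (@ordS n) a) = j.
Proof.
move=> jn; have an := ltn_ord a.
rewrite /gap val_iter_ordS; last lia.
by case: (ltnP (a + j) n) => ?; case: ifP => ?; lia.
Qed.

Lemma iter_ordS_n a : iter n (@ordS n) a = a.
Proof.
by apply: val_inj; rewrite /= val_iter_ordS //; have := ltn_ord a; case: ifP; lia.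
Qed.

Lemma mem_traject_ordS a m x :
  m <= n -> (x \in traject (@ordS n) a m) = (gap a x < m).
Proof.
move=> mn; apply/trajectP/idP => [[i im ->]|h]; first by rewrite gap_iter //; lia.
by exists (gap a x); rewrite // iter_gap.
Qed.

Lemma traject_ordS_uniq a m : m <= n -> uniq (traject (@ordS n) a m).
Proof.
elim: m a => // m IH a mn /=; rewrite IH ?andbT; last lia.
rewrite mem_traject_ordS; last lia.
have an := ltn_ord a; rewrite /gap ordS_val.
by case: (ltnP a.+1 n) => ?; [rewrite ltnn | rewrite leq0n]; lia.
Qed.

Lemma gap_gt0 a b : a != b -> 0 < gap a b.
Proof.
rewrite -val_eqE /= /gap; have := ltn_ord a; have := ltn_ord b.
by case: (leqP a b); lia.
Qed.

Lemma arc_cons a b : a != b -> a :: arc a b = traject (@ordS n) a (gap a b).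
Proof. by move=> /gap_gt0; rewrite /arc; case: gap. Qed.

Lemma arc_rcons a b :
  a != b -> rcons (arc a b) b = traject (@ordS n) (ordS a) (gap a b).
Proof.
move=> /gap_gt0; rewrite /arc -{3}(iter_gap a b); case: gap => // m _.
by rewrite trajectSr -iterSr.
Qed.

Lemma arc_uniq a b : uniq (arc a b).
Proof. by apply: traject_ordS_uniq; have := gap_lt a b; lia. Qed.

Lemma mem_arc_cons a b x : a != b -> (x \in a :: arc a b) = (gap a x < gap a b).
Proof. by move=> ab; rewrite arc_cons // mem_traject_ordS // ltnW ?gap_lt. Qed.

Lemma notin_arcl a b : a \notin arc a b.
Proof.
have [<-|ab] := eqVneq a b; first by rewrite /arc /gap leqnn subnn.
have: uniq (a :: arc a b) by rewrite arc_cons // traject_ordS_uniq // ltnW ?gap_lt.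
by case/andP.
Qed.

Definition cyc_adj a b : bool := (b == ordS a) || (a == ordS b).

Lemma cyc_adjC a b : cyc_adj a b = cyc_adj b a.
Proof. exact: orbC. Qed.

Lemma cyc_adj_ordS a : cyc_adj a (ordS a).
Proof. by rewrite /cyc_adj eqxx. Qed.

End Arcs.

(** * Edges of walks *)

Lemma set2_eq (T : finType) (a b c d : T) :
  [set a; b] = [set c; d] -> (a = c /\ b = d) \/ (a = d /\ b = c).
Proof.
move=> E.
have /set2P ha : a \in [set c; d] by rewrite -E set21.
have /set2P hb : b \in [set c; d] by rewrite -E set22.
have /set2P hc : c \in [set a; b] by rewrite E set21.
have /set2P hd : d \in [set a; b] by rewrite E set22.
by case: ha hb hc hd => -> [] -> [] ? [] ?; subst; auto.
Qed.

Section WalkEdges.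
Variable T : finType.
Implicit Types (x y : T) (s : seq T) (e : {set T}).

Lemma walk_edges0 x : walk_edges x [::] = set0.
Proof. by apply/setP=> e; rewrite !inE. Qed.

Lemma walk_edges_cons x y s :
  walk_edges x (y :: s) = [set x; y] |: walk_edges y s.
Proof. by apply/setP=> e; rewrite !inE. Qed.

Lemma walk_edges_rcons x y s :
  walk_edges x (rcons s y) = [set last x s; y] |: walk_edges x s.
Proof.
elim: s x => [|z s IH] x //=; first by rewrite walk_edges_cons.
by rewrite !walk_edges_cons IH setUCA.
Qed.

Lemma walk_edges_rev x y s :
  walk_edges y (rcons (rev s) x) = walk_edges x (rcons s y).
Proof.
elim: s x => [|z s IH] x; first by rewrite /= !walk_edges_cons [[set x; y]]setUC.
rewrite rev_cons walk_edges_rcons last_rcons IH rcons_cons walk_edges_cons.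
by rewrite [[set z; x]]setUC.
Qed.

Lemma walk_edges_sub x s e z : e \in walk_edges x s -> z \in e -> z \in x :: s.
Proof.
elim: s x => [|y s IH] x; first by rewrite walk_edges0 inE.
rewrite walk_edges_cons => /setU1P[->|/IH{}IH ze]; last by rewrite inE IH ?orbT.
by rewrite !inE => /orP[]->; rewrite ?orbT.
Qed.

End WalkEdges.

(** Stated for [traject] because arcs of a cycle are trajectories of [ordS]; the cycles
    of the graph are images of ['I_n] under [inl] and [inr], hence the map [g]. *)
Lemma walk_edges_map (T U : finType) (g : T -> U) (f : T -> T) x m :
  walk_edges (g x) (map g (traject f (f x) m)) =
  [set [set g z; g (f z)] | z in traject f x m].
Proof.
elim: m x => [|m IH] x /=.
  by rewrite walk_edges0; apply/esym/setP=> e; rewrite inE; apply/imsetP=> -[].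
rewrite walk_edges_cons IH; apply/setP=> e; rewrite !inE.
apply/orP/imsetP=> [[/eqP->|/imsetP[z zin ->]]|[z]].
- by exists x; rewrite // !inE eqxx.
- by exists z; rewrite // inE zin orbT.
rewrite inE => /orP[/eqP->->|zin ->]; [by left | right].
by apply/imsetP; exists z.
Qed.

(** * Five points on a cycle *)

Lemma ordS5_asym (i j : 'I_5) : j = ordS i -> i == ordS j = false.
Proof. by move=> ->; case: i => [[|[|[|[|[|?]]]]] ?]. Qed.

Lemma cyc_adj5_compl (i j : 'I_5) :
  (i != j) && ~~ cyc_adj i j = (j == ordS (ordS i)) || (i == ordS (ordS j)).
Proof. by case: i => [[|[|[|[|[|?]]]]] //= ?]; case: j => [[|[|[|[|[|?]]]]] //= ?]. Qed.

Section FivePoints.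
Variables (n : nat) (c : 'I_5 -> 'I_n).

(** Half-open arcs, so that the five sectors of a cyclically ordered family partition
    the cycle; apart from injectivity this is all that is used of the order. *)
Definition sector i : seq 'I_n := c i :: arc (c i) (c (ordS i)).

Definition cyclic_order : Prop :=
  [/\ injective c,
      forall x i j, x \in sector i -> x \in sector j -> i = j
    & forall x, exists i, x \in sector i].

(** The arc joining two neighbouring points of the family, listed from the [i]th to the
    [j]th; when [i] comes after [j] the arc is run backwards, because the two directions
    of a subdivided edge have to be reversals of each other. *)
Definition link i j : seq 'I_n :=
  if j == ordS i then arc (c i) (c j)
  else if i == ordS j then rev (arc (c j) (c i)) else [::].

(** The sectors of an increasing family are the intervals between its members, except
    the last one, which wraps around the end of ['I_n]. *)
Lemma increasing_cyclic_order : {homo c : i j / i < j} -> cyclic_order.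
Proof.
move=> inc; have cinj : injective c.
  move=> i j E; apply: val_inj.
  by case: (ltngtP i j) => // /inc; rewrite E ltnn.
have cne i : c i != c (ordS i) by rewrite (inj_eq cinj) ordS_neq.
pose v a : nat := c (inord a).
have cv i : c i = v i :> nat by rewrite /v inord_val.
have vn a : v a < n by exact: ltn_ord.
have vlt a b : a < b -> b < 5 -> v a < v b.
  by move=> ab b5; apply: inc; rewrite !inordK //; lia.
have [h1 h2 h3 h4] : [/\ v 0 < v 1, v 1 < v 2, v 2 < v 3 & v 3 < v 4].
  by split; apply: vlt.
have hn := vn 4.
(* The case [i = 4] is the sector that wraps around. *)
have inS x i : (x \in sector i) =
    if i < 4 then v i <= x < v i.+1 else (v 4 <= x) || (x < v 0).
  rewrite /sector mem_arc_cons // /gap !cv; have := ltn_ord x; rewrite /=.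
  case: i => [[|[|[|[|[|?]]]]] //= ?] xn; rewrite ?modnn ?modn_small //;
    split_ifs; lia.
split=> //.
  move=> x i j; rewrite !inS => hi hj; apply: val_inj; move: hi hj.
  by case: i => [[|[|[|[|[|?]]]]] //= ?]; case: j => [[|[|[|[|[|?]]]]] //= ?]; lia.
move=> x.
have [lt0|ge0] := ltnP x (v 0); first by exists (inord 4); rewrite inS inordK //= lt0 orbT.
have [lt1|ge1] := ltnP x (v 1); first by exists (inord 0); rewrite inS inordK //= ge0.
have [lt2|ge2] := ltnP x (v 2); first by exists (inord 1); rewrite inS inordK //= ge1.
have [lt3|ge3] := ltnP x (v 3); first by exists (inord 2); rewrite inS inordK //= ge2.
have [lt4|ge4] := ltnP x (v 4); first by exists (inord 3); rewrite inS inordK //= ge3.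
by exists (inord 4); rewrite inS inordK //= ge4.
Qed.

Lemma linkC i j : link j i = rev (link i j).
Proof.
rewrite /link; case: (eqVneq j (ordS i)) => [E|_].
  by rewrite (ordS5_asym E).
by case: (i == ordS j); rewrite ?revK.
Qed.

Lemma link_uniq i j : uniq (link i j).
Proof. by rewrite /link; do 2?case: eqP => _ //; rewrite ?rev_uniq arc_uniq. Qed.

Lemma mem_link i j x :
  x \in link i j ->
  exists2 r, [set i; j] = [set r; ordS r] & x \in arc (c r) (c (ordS r)).
Proof.
rewrite /link; case: eqP => [-> h|_]; first by exists i.
by case: eqP => [-> h|//]; exists j; [rewrite setUC | rewrite -mem_rev].
Qed.

Hypothesis cP : cyclic_order.

Lemma cyclic_orderS i : c i != c (ordS i).
Proof. by case: cP => inj _ _; rewrite (inj_eq inj) ordS_neq. Qed.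

Lemma notin_arc r i : c i \notin arc (c r) (c (ordS r)).
Proof.
case: cP => inj disj _; apply/negP => h.
have E : i = r by apply: (disj (c i)); rewrite inE ?eqxx ?h ?orbT.
by move: h; rewrite E; apply/negP/notin_arcl.
Qed.

Lemma arc_disjoint r s x :
  x \in arc (c r) (c (ordS r)) -> x \in arc (c s) (c (ordS s)) -> r = s.
Proof. by case: cP => _ disj _ hr hs; apply: (disj x); rewrite inE ?hr ?hs orbT. Qed.

Lemma arc_walk (T : finType) (g : 'I_n -> T) r :
  walk_edges (g (c r)) (rcons (map g (arc (c r) (c (ordS r)))) (g (c (ordS r)))) =
  [set [set g z; g (ordS z)] | z in sector r].
Proof.
have ne := cyclic_orderS r.
rewrite -map_rcons arc_rcons // walk_edges_map; apply/setP=> e.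
by apply/imsetP/imsetP=> -[z zr ->]; exists z; move: zr; rewrite // /sector arc_cons.
Qed.

Lemma link_walk (T : finType) (g : 'I_n -> T) i j :
  cyc_adj i j ->
  exists2 r, [set i; j] = [set r; ordS r] &
  walk_edges (g (c i)) (rcons (map g (link i j)) (g (c j))) =
  [set [set g z; g (ordS z)] | z in sector r].
Proof.
have [E _|ne] := eqVneq j (ordS i).
  by exists i; rewrite E // /link eqxx arc_walk.
rewrite /cyc_adj (negPf ne) /= => /eqP E; exists j; first by rewrite E setUC.
by rewrite linkC map_rev walk_edges_rev /link E eqxx arc_walk.
Qed.

End FivePoints.

(** * The Petersen graph *)

Definition petersen_adj (u v : 'I_5 + 'I_5) : bool :=
  match u, v with
  | inl i, inl j => cyc_adj i j
  | inr i, inr j => (i != j) && ~~ cyc_adj i j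
  | inl i, inr j | inr i, inl j => i == j
  end.

Lemma petersen_edgeE u v : ([set u; v] \in eset petersen) = petersen_adj u v.
Proof.
rewrite /eset /= /petersen_edges !inE.
apply/idP/idP.
  case/orP=> [/orP[]|] /imsetP[i _ /set2_eq[][-> ->]] //=; rewrite ?cyc_adj_ordS //.
  - by rewrite cyc_adjC cyc_adj_ordS.
  - by rewrite cyc_adj5_compl eqxx.
  - by rewrite cyc_adj5_compl eqxx orbT.
case: u v => i [] j /=.
- case/orP=> /eqP->; apply/orP; left; apply/orP; left; apply/imsetP.
    by exists i.
  by exists j; rewrite // setUC.
- by move=> /eqP->; apply/orP; right; apply/imsetP; exists j.
- by move=> /eqP->; apply/orP; right; apply/imsetP; exists j; rewrite // setUC.
rewrite cyc_adj5_compl.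
case/orP=> /eqP->; apply/orP; left; apply/orP; right; apply/imsetP.
  by exists i.
by exists j; rewrite // setUC.
Qed.

Lemma petersen_adjC u v : petersen_adj u v = petersen_adj v u.
Proof. by rewrite -!petersen_edgeE setUC. Qed.

(** Part of the fact that the Petersen graph has girth 5. *)
Lemma petersen_no_square (u v w z : 'I_5 + 'I_5) :
  petersen_adj u v -> petersen_adj v w -> petersen_adj w z -> petersen_adj z u ->
  (u == w) || (v == z).
Proof.
pose o := [:: Ordinal (isT : 0 < 5); Ordinal (isT : 1 < 5); Ordinal (isT : 2 < 5);
             Ordinal (isT : 3 < 5); Ordinal (isT : 4 < 5)].
pose V : seq ('I_5 + 'I_5) := [seq inl i | i <- o] ++ [seq inr i | i <- o].
have inV x : x \in V.
  by case: x => -[[|[|[|[|[|?]]]]] //= ?]; rewrite /V /= !inE.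
have : all (fun u => all (fun v => petersen_adj u v ==> all (fun w =>
    petersen_adj v w ==> all (fun z => petersen_adj w z ==> petersen_adj z u ==>
    ((u == w) || (v == z))) V) V) V) V by vm_compute.
move=> /allP/(_ u (inV u))/allP/(_ v (inV v))/implyP H /H.
move=> /allP/(_ w (inV w))/implyP{}H /H /allP/(_ z (inV z))/implyP{}H /H.
by move=> /implyP.
Qed.

Lemma petersen_degree (u : 'I_5 + 'I_5) :
  exists v : seq ('I_5 + 'I_5), [/\ uniq v, size v = 3 & all (petersen_adj u) v].
Proof.
case: u => i.
  exists [:: inl (ordS i); inl (ord_pred i); inr i]; split=> //.
    rewrite /= !inE /= andbT orbF; apply/eqP => -[].
    by case: i => [[|[|[|[|[|?]]]]] ?].
  by rewrite /= cyc_adj_ordS eqxx /cyc_adj ord_predK eqxx orbT.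
exists [:: inr (ordS (ordS i)); inr (ord_pred (ord_pred i)); inl i]; split=> //.
  rewrite /= !inE /= andbT orbF; apply/eqP => -[].
  by case: i => [[|[|[|[|[|?]]]]] ?].
by rewrite /= !cyc_adj5_compl eqxx !ord_predK eqxx orbT.
Qed.

Lemma cyc_adj5_irr (i : 'I_5) : cyc_adj i i = false.
Proof. by case: i => [[|[|[|[|[|?]]]]] ?]. Qed.

(** The complement of a pentagon on five points is again a pentagon: a point [i] has two
    non-neighbours.  If [j] is one of them and [s j] were not adjacent to [s i], then the
    preimages of the two neighbours of [s i] would be a second and a third one. *)
Lemma pentagram_of_no_common_edge (s : 'I_5 -> 'I_5) :
  injective s -> (forall i j, cyc_adj i j -> ~~ cyc_adj (s i) (s j)) ->
  forall i j, cyc_adj (s i) (s j) = (i != j) && ~~ cyc_adj i j.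
Proof.
move=> s_inj h i j; apply/idP/idP=> [r|/andP[ij nr]].
  apply/andP; split; first by apply: contraTneq r => ->; rewrite cyc_adj5_irr.
  by apply: contraL r; apply: h.
have far k : i != k -> ~~ cyc_adj i k ->
    k \in [:: ordS (ordS i); ord_pred (ord_pred i)].
  move=> ik nk; have := cyc_adj5_compl i k; rewrite ik nk /= !inE => /esym/orP[->//|/eqP->].
  by rewrite !ordSK eqxx orbT.
have [t _ st] := injF_bij s_inj.
have near r : cyc_adj (s i) r -> t r \in [:: ordS (ordS i); ord_pred (ord_pred i)].
  move=> ir; apply: far; first by apply: contraTneq ir => ->; rewrite st cyc_adj5_irr.
  by apply: contraTN ir => /h; rewrite st.
apply: contraT => nsij.
have := @uniq_leq_size _ [:: j; t (ordS (s i)); t (ord_pred (s i))]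
  [:: ordS (ordS i); ord_pred (ord_pred i)].
have r1 : cyc_adj (s i) (ordS (s i)) by exact: cyc_adj_ordS.
have r2 : cyc_adj (s i) (ord_pred (s i)) by rewrite /cyc_adj ord_predK eqxx orbT.
move=> H; suff: 2 < 2 by []; apply: H.
  rewrite /= !inE /= andbT negb_or; apply/andP; split; first apply/andP; first split.
  - by apply: contraNneq nsij => ->; rewrite st.
  - by apply: contraNneq nsij => ->; rewrite st.
  - rewrite (can_eq st); case: (s i) => [[|[|[|[|[|?]]]]] ?] //.
move=> k; rewrite in_cons => /orP[/eqP->|]; first exact: far.
by rewrite in_cons => /orP[/eqP->|]; [exact: near | rewrite mem_seq1 => /eqP->; exact: near].
Qed.

(** * Branch vertices of a subdivision *)

(** The hypotheses of the section are the clauses of [is_subdivision], for arbitrary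
    graphs; [span x y] is the whole path replacing the edge [xy], ends included. *)
Section Branch.
Variables (U T : finType) (P : sgraph U) (H : sgraph T).
Variables (f : U -> T) (p : U -> U -> seq T).
Hypothesis f_inj : {in vset P &, injective f}.
Hypothesis pP : forall x y, [set x; y] \in eset P ->
  [/\ p y x = rev (p x y), uniq (p x y)
    & {in p x y, forall z, z \notin f @: vset P}].
Hypothesis p_disj : forall x y x' y', [set x; y] \in eset P ->
  [set x'; y'] \in eset P -> [set x; y] != [set x'; y'] ->
  {in p x y, forall z, z \notin p x' y'}.
Hypothesis HE : eset H = \bigcup_(a : U * U | [set a.1; a.2] \in eset P)
                   walk_edges (f a.1) (rcons (p a.1 a.2) (f a.2)).

Let B := f @: vset P.
Let span x y := f x :: rcons (p x y) (f y).

Lemma edge_vset (x y : U) : [set x; y] \in eset P -> x \in vset P.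
Proof.
move=> xy; have /forall_inP/(_ _ xy)/andP[_ /subsetP] := valP P.
by apply; rewrite set21.
Qed.

Let edgeC (x y : U) : [set x; y] \in eset P -> [set y; x] \in eset P.
Proof. by rewrite setUC. Qed.

Let spanC x y z : [set x; y] \in eset P -> (z \in span y x) = (z \in span x y).
Proof.
by move=> /pP[E _ _]; rewrite /span E !inE !mem_rcons !inE mem_rev orbCA.
Qed.

Let edge_span a b : [set a; b] \in eset H ->
  exists x y, [/\ [set x; y] \in eset P, a \in span x y & b \in span x y].
Proof.
rewrite HE => /bigcupP[[x y] /= xy abw]; exists x, y.
by split=> //; apply: walk_edges_sub abw _; rewrite ?set21 ?set22.
Qed.

Let span_branch x y z :
  [set x; y] \in eset P -> z \in span x y -> z \in B -> z = f x \/ z = f y.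
Proof.
move=> xy zs zB; have [_ _ pB] := pP xy.
move: zs; rewrite !inE mem_rcons inE => /or3P[/eqP|/eqP|/pB]; auto.
by rewrite zB.
Qed.

Let span_inner x y z :
  [set x; y] \in eset P -> z \in span x y -> z \notin B -> z \in p x y.
Proof.
move=> xy + zB; rewrite !inE mem_rcons inE => /or3P[/eqP E|/eqP E|//].
  by rewrite E imset_f // (edge_vset xy) in zB.
by rewrite E imset_f // (edge_vset (edgeC xy)) in zB.
Qed.

(** An inner vertex lies on one replacing path only, so its edges stay on that path. *)
Let inner_step x y a b : [set x; y] \in eset P -> a \in p x y ->
  [set a; b] \in eset H -> b \in span x y.
Proof.
move=> xy ap ab; have [_ _ pB] := pP xy.
have [x' [y' [xy' as' bs]]] := edge_span ab.
have ap' := span_inner xy' as' (pB a ap).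
have [E|ne] := eqVneq [set x; y] [set x'; y']; last first.
  by have := p_disj xy xy' ne ap; rewrite ap'.
by case: (set2_eq E) => -[-> ->]; rewrite // spanC.
Qed.

Let inner_path x y a t v : [set x; y] \in eset P -> a \in p x y ->
  path (fun a b => [set a; b] \in eset H) a (rcons t v) ->
  {in t, forall z, z \notin B} -> v \in span x y.
Proof.
move=> xy; elim: t a => [|b t IH] a ap /=; first by rewrite andbT => /(inner_step xy ap).
move=> /andP[/(inner_step xy ap) bs bt] tB.
apply: (IH b) => //; last by move=> z zt; apply: tB; rewrite inE zt orbT.
by apply: span_inner => //; apply: tB; rewrite mem_head.
Qed.

(** The path enters the replacing path of some edge [xy] with its first step and cannot
    leave it before it meets a branch vertex; as that vertex is not [f x], it is the
    other end of the replacing path. *)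
Lemma branch_path x t v : x \in vset P ->
  path (fun a b => [set a; b] \in eset H) (f x) (rcons t v) ->
  {in t, forall z, z \notin B} -> v \in B -> v != f x ->
  exists2 y, v = f y & [set x; y] \in eset P.
Proof.
move=> xP pt tB vB vx.
have [y xy ws] : exists2 y, [set x; y] \in eset P & head v t \in span x y.
  have [|x' [y' [xy' xs ws]]] := @edge_span (f x) (head v t).
    by case: t {tB} pt => [|w t] /= /andP[].
  have [|/f_inj E|/f_inj E] := span_branch xy' xs; first exact: imset_f.
    by exists y'; rewrite E ?(edge_vset xy').
  by exists x'; rewrite E ?(edge_vset (edgeC xy')) ?(spanC _ xy') // setUC.
suff vs : v \in span x y.
  by exists y => //; case: (span_branch xy vs vB) => // E; rewrite E eqxx in vx.
case: t pt tB ws => [//|w t] /= /andP[_ wt] tB ws.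
apply: (inner_path xy _ wt) => [|z zt]; last by apply: tB; rewrite inE zt orbT.
by apply: span_inner => //; apply: tB; rewrite mem_head.
Qed.

(** The replacing paths that start at [f x] have distinct first vertices: a shared one
    would be an inner vertex of two of them, or an inner vertex of one and a branch
    vertex. *)
Lemma branch_degree x (ys : seq U) :
  uniq ys -> (forall y, y \in ys -> [set x; y] \in eset P) ->
  exists ws, [/\ uniq ws, size ws = size ys
    & forall w, w \in ws -> [set f x; w] \in eset H].
Proof.
move=> ys_uniq ysP; exists [seq head (f y) (p x y) | y <- ys]; split.
- rewrite map_inj_in_uniq // => y y' /ysP xy /ysP xy' E.
  have [_ _ pB] := pP xy; have [_ _ pB'] := pP xy'.
  have yP := edge_vset (edgeC xy); have yP' := edge_vset (edgeC xy').
  have [//|ne] := eqVneq y y'.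
  have /(p_disj xy xy') disj : [set x; y] != [set x; y'].
    by apply: contraNneq ne => /set2_eq[][]; [move=> _ -> | move=> -> ->].
  case: (p x y) (p x y') E pB pB' disj => [|w t] [|w' t'] /= E pB pB' disj.
  + exact: f_inj.
  + by have := pB' w' (mem_head _ _); rewrite -E imset_f.
  + by have := pB w (mem_head _ _); rewrite E imset_f.
  + by have := disj w (mem_head _ _); rewrite E mem_head.
- by rewrite size_map.
move=> _ /mapP[y /ysP xy ->]; rewrite HE; apply/bigcupP; exists (x, y) => //=.
by case: (p x y) => [|w t] /=; rewrite walk_edges_cons setU11.
Qed.

End Branch.

(** * Two cycles joined by spokes *)

Section Spoked.
Variables (n : nat) (pi : 'I_n -> 'I_n).
Hypotheses (n_gt2 : 2 < n) (pi_inj : injective pi).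

Let V : finType := ('I_n + 'I_n)%type.
Implicit Types (S : {set 'I_n}) (u v : V).

Definition spoke (i : 'I_n) : {set V} := [set inl i; inr (pi i)].

(** Two cycles of length [n] and the spokes of index in [S].  With all spokes this is the
    marked permutation graph of [pi]; the candidates for copies of the Petersen graph
    are the graphs with five spokes, so both are instances of one definition. *)
Definition spoked_edges S : {set {set V}} :=
  [set [set inl i; inl (ordS i)] | i : 'I_n]
  :|: [set [set inr i; inr (ordS i)] | i : 'I_n]
  :|: [set spoke i | i in S].

Lemma inl_eq (i j : 'I_n) : (inl i == inl j :> V) = (i == j).
Proof. by apply: inj_eq => ? ? []. Qed.

Lemma inr_eq (i j : 'I_n) : (inr i == inr j :> V) = (i == j).
Proof. by apply: inj_eq => ? ? []. Qed.

Lemma spoked_subproof S : graph_axiom ([set: V], spoked_edges S).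
Proof.
have n1 : 1 < n by lia.
apply/forall_inP => e /=; rewrite subsetT andbT !inE.
case/orP=> [/orP[]|] /imsetP[i _ ->]; rewrite cards2 //.
  by rewrite inl_eq ordS_neq.
by rewrite inr_eq ordS_neq.
Qed.

Definition spoked S : sgraph V := SGraph (spoked_subproof S).

Definition spoked_adj S u v : bool :=
  match u, v with
  | inl i, inl j | inr i, inr j => cyc_adj i j
  | inl i, inr j | inr j, inl i => (i \in S) && (j == pi i)
  end.

Lemma spoked_edgeE S u v : ([set u; v] \in eset (spoked S)) = spoked_adj S u v.
Proof.
rewrite /eset /= /spoked_edges !inE.
apply/idP/idP.
  case/orP=> [/orP[]|] /imsetP[i iS /set2_eq[][-> ->]] /=; rewrite /cyc_adj ?eqxx ?iS ?orbT //.
case: u v => i [] j /=.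
- case/orP=> /eqP->; apply/orP; left; apply/orP; left; apply/imsetP.
    by exists i.
  by exists j; rewrite // setUC.
- by case/andP=> iS /eqP->; apply/orP; right; apply/imsetP; exists i.
- by case/andP=> iS /eqP->; apply/orP; right; apply/imsetP; exists j; rewrite // /spoke setUC.
case/orP=> /eqP->; apply/orP; left; apply/orP; right; apply/imsetP.
  by exists i.
by exists j; rewrite // setUC.
Qed.

Lemma spoke_inj : injective spoke.
Proof. by move=> i j /set2_eq[] [] // []. Qed.

Lemma spoke_edge S i : (spoke i \in eset (spoked S)) = (i \in S).
Proof. by rewrite spoked_edgeE /= eqxx andbT. Qed.

Lemma spoked_inj : injective spoked.
Proof. by move=> S S' E; apply/setP=> i; rewrite -!spoke_edge E. Qed.

Lemma spoked_edgesD S :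
  spoked_edges S :\: [set spoke i | i : 'I_n] = spoked_edges set0.
Proof.
apply/setP=> e; rewrite !inE imset0 inE orbF.
have [/imsetP[i _ ->]|/negP ne] := boolP (e \in [set spoke i | i : 'I_n]) => /=.
  by symmetry; apply/negbTE; apply/negP;
    case/orP=> /imsetP[j _ /set2_eq[] []].
rewrite -[RHS]orbF; congr (_ || _); apply/negbTE/imsetP=> -[i iS E]; case: ne; rewrite E.
by apply/imsetP; exists i.
Qed.

(** ** The copies of the Petersen graph *)

(** The ends of the five spokes are listed in cyclic order on both cycles, by [c] and [d];
    [s] is the bijection between the two numberings that the spokes induce. *)
Section Copy.
Variables (S : {set 'I_n}) (c d : 'I_5 -> 'I_n) (s : 'I_5 -> 'I_5).
Hypotheses (cP : cyclic_order c) (dP : cyclic_order d) (s_inj : injective s).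
Hypotheses (cS : S = [set c i | i : 'I_5]) (cds : forall i, pi (c i) = d (s i)).

Section Subdivide.
Hypothesis sP : forall i j, cyc_adj (s i) (s j) = (i != j) && ~~ cyc_adj i j.

Let f (x : 'I_5 + 'I_5) : V :=
  match x with inl i => inl (c i) | inr i => inr (d (s i)) end.

Let p (x y : 'I_5 + 'I_5) : seq V :=
  match x, y with
  | inl i, inl j => map inl (link c i j)
  | inr i, inr j => map inr (link d (s i) (s j))
  | _, _ => [::]
  end.

Let inl_inj' : injective (inl : 'I_n -> V). Proof. by move=> ? ? []. Qed.
Let inr_inj' : injective (inr : 'I_n -> V). Proof. by move=> ? ? []. Qed.

Let s_pre r : exists i, s i = r.
Proof. by have [t _ st] := injF_bij s_inj; exists (t r). Qed.

Let branchE z : (z \in f @: [set: 'I_5 + 'I_5]) =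
  match z with inl i => i \in [set c j | j : 'I_5] | inr i => i \in [set d j | j : 'I_5] end.
Proof.
apply/imsetP/idP=> [[[] i _ ->]|] /=; try exact: imset_f.
case: z => i /imsetP[j _ ->]; first by exists (inl j); rewrite ?inE.
by have [r <-] := s_pre j; exists (inr r); rewrite ?inE.
Qed.

Let link_branch (e : 'I_5 -> 'I_n) i j x :
  cyclic_order e -> x \in link e i j -> x \notin [set e j | j : 'I_5].
Proof.
move=> eP /mem_link[r _ xr]; apply/imsetP=> -[k _ E].
by move: (notin_arc eP r k); rewrite -E xr.
Qed.

Let link_disjoint (e : 'I_5 -> 'I_n) i j i' j' x :
  cyclic_order e -> x \in link e i j -> x \in link e i' j' ->
  [set i; j] = [set i'; j'].
Proof. by move=> eP /mem_link[r -> xr] /mem_link[t -> /(arc_disjoint eP xr)->]. Qed.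

Let walk_of x y := walk_edges (f x) (rcons (p x y) (f y)).

Let walk_sub x y : petersen_adj x y -> walk_of x y \subset eset (spoked S).
Proof.
case: x y => i [] j /=; rewrite /walk_of.
- move=> /(link_walk cP (inl : 'I_n -> V))[r _] /= ->.
  apply/subsetP=> _ /imsetP[z _ ->].
  by rewrite spoked_edgeE /= /cyc_adj eqxx.
- move/eqP->; rewrite walk_edges_cons walk_edges0 setU0 sub1set spoked_edgeE /=.
  by rewrite -cds eqxx cS imset_f.
- move/eqP->; rewrite walk_edges_cons walk_edges0 setU0 sub1set spoked_edgeE /=.
  by rewrite -cds eqxx cS imset_f.
rewrite -sP => /(link_walk dP (inr : 'I_n -> V))[r _] /= ->.
apply/subsetP=> _ /imsetP[z _ ->].
by rewrite spoked_edgeE /= /cyc_adj eqxx.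
Qed.

(** The outer pentagon of the Petersen graph goes to the first cycle; on the second cycle
    the arcs join the points [s i] and [s j] that are neighbours, and by [sP] these are
    the edges [ij] of the inner pentagram. *)
Lemma pentagram_subdivision : is_subdivision petersen (spoked S).
Proof.
exists f, p; split.
- move=> [] i [] j _ _ //= [] E; first by case: cP => inj _ _; rewrite (inj _ _ E).
  by case: dP => inj _ _; rewrite (s_inj (inj _ _ E)).
- move=> x y; rewrite petersen_edgeE => xy; split.
  + by case: x y {xy} => i [] j //=; rewrite linkC map_rev.
  + by case: x y {xy} => i [] j //=; rewrite map_inj_uniq // link_uniq.
  + case: x y {xy} => i [] j //= z /mapP[w wl ->]; rewrite branchE; exact: link_branch wl.
- move=> x y x' y' _ _; case: x y x' y' => i [] j [] i' [] j' //= ne z /mapP[w wl ->];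
    apply/mapP=> -[w' wl' h] //; case/eqP: ne.
  + rewrite -(inl_inj' h) in wl'.
    by rewrite -!imset_set1 -!imsetU (link_disjoint cP wl wl').
  + rewrite -(inr_inj' h) in wl'.
    have E : [set i; j] = [set i'; j'].
      apply: (imset_inj s_inj).
      by rewrite !imsetU !imset_set1 (link_disjoint dP wl wl').
    by rewrite -!imset_set1 -!imsetU E.
- apply/eqP; rewrite eq_sym eqEsubset subsetT; apply/subsetP=> z _; rewrite inE branchE.
  case: z => x.
    have [r xr] : exists r, x \in sector c r by case: cP.
    move: xr; rewrite inE => /orP[/eqP->|xr]; first by rewrite imset_f.
    apply/orP; right; apply/bigcupP; exists (inl r, inl (ordS r)).
      by rewrite petersen_edgeE /= cyc_adj_ordS.
    by rewrite inE /= map_f // /link eqxx.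
  have [r xr] : exists r, x \in sector d r by case: dP.
  move: xr; rewrite inE => /orP[/eqP->|xr]; first by rewrite imset_f.
  have [[i si] [j sj]] := (s_pre r, s_pre (ordS r)).
  apply/orP; right; apply/bigcupP; exists (inr i, inr j).
    by rewrite petersen_edgeE /= -sP si sj cyc_adj_ordS.
  by rewrite inE /= map_f // /link si sj eqxx.
- apply/eqP; rewrite eqEsubset; apply/andP; split; last first.
    apply/bigcupsP=> -[x y]; rewrite petersen_edgeE; exact: walk_sub.
  apply/subsetP=> e; rewrite 2!inE => /orP[/orP[]|] /imsetP[x xS ->].
  + have [r xr] : exists r, x \in sector c r by case: cP.
    apply/bigcupP; exists (inl r, inl (ordS r)).
      by rewrite petersen_edgeE /= cyc_adj_ordS.
    by rewrite /= /link eqxx (arc_walk cP (inl : 'I_n -> V)); apply/imsetP; exists x.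
  + have [r xr] : exists r, x \in sector d r by case: dP.
    have [[i si] [j sj]] := (s_pre r, s_pre (ordS r)).
    apply/bigcupP; exists (inr i, inr j).
      by rewrite petersen_edgeE /= -sP si sj cyc_adj_ordS.
    by rewrite /= /link si sj eqxx (arc_walk dP (inr : 'I_n -> V)); apply/imsetP; exists x.
  + move: xS; rewrite cS => /imsetP[i _ ->].
    apply/bigcupP; exists (inl i, inr i).
      by rewrite petersen_edgeE /=.
    by rewrite /= walk_edges_cons walk_edges0 setU0 inE /spoke cds.
Qed.

End Subdivide.

Section Subdivided.
Hypothesis subd : is_subdivision petersen (spoked S).

Let end_points : {set V} := [set inl (c i) | i : 'I_5] :|: [set inr (d i) | i : 'I_5].

Let spoked_degree z :
  z \notin end_points ->
  exists a b, forall w, [set z; w] \in eset (spoked S) -> w \in [:: a; b].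
Proof.
rewrite inE negb_or => /andP[zl zr].
case: z zl zr => x zl zr; [exists (inl (ordS x)), (inl (ord_pred x)) |
                           exists (inr (ordS x)), (inr (ord_pred x))];
  move=> [] w; rewrite spoked_edgeE /= !inE.
- by rewrite !inl_eq => /orP[->//|/eqP->]; rewrite ordSK eqxx orbT.
- move=> /andP[xS _]; case/negP: zl; move: xS; rewrite cS => /imsetP[i _ ->].
  by apply/imsetP; exists i.
- move=> /andP[wS /eqP xw]; case/negP: zr; move: wS xw; rewrite cS => /imsetP[i _ ->] ->.
  by rewrite cds; apply/imsetP; exists (s i).
- by rewrite !inr_eq => /orP[->//|/eqP->]; rewrite ordSK eqxx orbT.
Qed.

Let ring_path (g : 'I_n -> V) (e : 'I_5 -> 'I_n) r :
  cyclic_order e ->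
  (forall x, [set g x; g (ordS x)] \in eset (spoked S)) ->
  path (fun a b => [set a; b] \in eset (spoked S)) (g (e r))
    (rcons (map g (arc (e r) (e (ordS r)))) (g (e (ordS r)))).
Proof.
move=> eP gP; have := cyclic_orderS eP r => ne.
rewrite -map_rcons arc_rcons //; move: (gap _ _) => m.
by elim: m (e r) => //= m IH a; rewrite gP IH.
Qed.

(** A counterexample [i], [j] yields the ends of two spokes, joined by an arc on either
    side: this is a 4-cycle of the Petersen graph. *)
Lemma subdivision_no_common_edge i j : cyc_adj i j -> ~~ cyc_adj (s i) (s j).
Proof.
move=> ij; apply/negP=> sij.
have [f [p [f_inj pP p_disj _ HE]]] := subd.
set B := f @: vset petersen in pP.
have fB x : f x \in B by rewrite imset_f ?inE.
have card_B : #|B| = 10 by rewrite card_in_imset // cardsT card_sum !card_ord.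
(* Vertices other than the ends have degree 2, branch vertices have degree at least 3;
   the inclusion is an equality because there are ten of each. *)
have BE : B = end_points.
  apply/eqP; rewrite eqEcard card_B; apply/andP; split; last first.
    rewrite (leq_trans (leq_card_setU _ _)) // (leq_add (n1 := 5) (n2 := 5)) //.
      by rewrite (leq_trans (leq_imset_card _ _)) // card_ord.
    by rewrite (leq_trans (leq_imset_card _ _)) // card_ord.
  apply/subsetP=> _ /imsetP[x _ ->]; apply: contraT => /spoked_degree[a [b nbrs]].
  have [ys [ys_uniq ys3 /allP ysx]] := petersen_degree x.
  have [|ws [ws_uniq wsE wsx]] := branch_degree f_inj pP p_disj HE ys_uniq (x := x).
    by move=> y /ysx; rewrite petersen_edgeE.
  have := uniq_leq_size ws_uniq (s2 := [:: a; b]).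
  by rewrite wsE ys3; apply => w /wsx /nbrs.
have preim z : z \in end_points -> exists x, f x = z.
  by rewrite -BE => /imsetP[x _ ->]; exists x.
have [a fa] : exists a, forall k, f (a k) = inl (c k).
  apply: (@fin_all_exists _ (fun _ => _) (fun k x => f x = inl (c k))) => k.
  by apply: preim; rewrite inE; apply/orP; left; apply/imsetP; exists k.
have [b fb] : exists b, forall k, f (b k) = inr (d k).
  apply: (@fin_all_exists _ (fun _ => _) (fun k x => f x = inr (d k))) => k.
  by apply: preim; rewrite inE; apply/orP; right; apply/imsetP; exists k.
have f_inj' x y : f x = f y -> x = y by apply: f_inj; rewrite inE.
have linked x y t : x != y ->
    path (fun a b => [set a; b] \in eset (spoked S)) (f x) (rcons t (f y)) ->
    {in t, forall z, z \notin end_points} -> petersen_adj x y.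
  move=> xy pt tB; rewrite -petersen_edgeE.
  have tB' : {in t, forall z, z \notin B} by rewrite BE.
  have xP : x \in vset petersen by rewrite inE.
  have yx : f y != f x by apply: contraNneq xy => /f_inj'->.
  by have [y' /f_inj' ->] := branch_path f_inj pP p_disj HE xP pt tB' (fB y) yx.
have aP k l : cyc_adj k l -> petersen_adj (a k) (a l).
  wlog -> : k l / l = ordS k => [H|_].
    case/orP=> /eqP E; first by apply: H; rewrite ?E ?cyc_adj_ordS.
    by rewrite petersen_adjC; apply: H; rewrite ?E ?cyc_adj_ordS.
  apply: (linked _ _ (map inl (arc (c k) (c (ordS k))))).
  - apply: contraNneq (cyclic_orderS cP k) => E.
    by have := fa k; rewrite E fa => -[->].
  - rewrite !fa; apply: (ring_path (g := inl)) => // x.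
    by rewrite spoked_edgeE /= /cyc_adj eqxx.
  move=> _ /mapP[x xk ->]; rewrite !inE; apply/norP; split; last by apply/imsetP=> -[].
  by apply/imsetP=> -[l' _ [E]]; have := notin_arc cP k l'; rewrite -E xk.
have bP k l : cyc_adj k l -> petersen_adj (b k) (b l).
  wlog -> : k l / l = ordS k => [H|_].
    case/orP=> /eqP E; first by apply: H; rewrite ?E ?cyc_adj_ordS.
    by rewrite petersen_adjC; apply: H; rewrite ?E ?cyc_adj_ordS.
  apply: (linked _ _ (map inr (arc (d k) (d (ordS k))))).
  - apply: contraNneq (cyclic_orderS dP k) => E.
    by have := fb k; rewrite E fb => -[->].
  - rewrite !fb; apply: (ring_path (g := inr)) => // x.
    by rewrite spoked_edgeE /= /cyc_adj eqxx.
  move=> _ /mapP[x xk ->]; rewrite !inE; apply/norP; split; first by apply/imsetP=> -[].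
  by apply/imsetP=> -[l' _ [E]]; have := notin_arc dP k l'; rewrite -E xk.
have ab x y : a x != b y.
  by apply/eqP=> E; have := fa x; rewrite E fb.
have abP k : petersen_adj (a k) (b (s k)).
  apply: (linked _ _ [::]); rewrite ?ab //= fa fb andbT.
  by rewrite spoked_edgeE /= cS cds imset_f ?eqxx.
have bji : petersen_adj (b (s j)) (b (s i)) by rewrite petersen_adjC bP.
have bai : petersen_adj (b (s i)) (a i) by rewrite petersen_adjC.
by have := petersen_no_square (aP _ _ ij) (abP j) bji bai; rewrite !(negPf (ab _ _)).
Qed.

End Subdivided.

Lemma subdivisionP :
  is_subdivision petersen (spoked S) <->
  forall i j, cyc_adj i j -> ~~ cyc_adj (s i) (s j).
Proof.
split=> [subd i j|star]; first exact: subdivision_no_common_edge.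
exact: pentagram_subdivision (pentagram_of_no_common_edge s_inj star).
Qed.

End Copy.

(** ** The marked permutation graph *)

Definition spokes : {set {set V}} := [set spoke i | i : 'I_n].

Lemma spoked_edges_split S : spoked_edges S = spoked_edges set0 :|: [set spoke i | i in S].
Proof. by rewrite /spoked_edges imset0 setU0. Qed.

Lemma spoked_del_edges : eset (del_edges (spoked setT) spokes) = spoked_edges set0.
Proof. exact: spoked_edgesD. Qed.

(** The spokes of a copy are those of a set of indices, so copies can be counted as sets
    of five indices. *)
Lemma petersen_copyP (H : sgraph V) :
  is_petersen_copy (spoked setT) spokes H <->
  exists S, [/\ #|S| = 5, is_subdivision petersen (spoked S) & H = spoked S].
Proof.
split=> [[_ subd [F [FM F5 HV HE]]]|[S [S5 subd ->]]]; last first.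
  split=> //.
    rewrite /subgraph subxx /= /eset /= !(spoked_edges_split S) !(spoked_edges_split setT) setUS //.
    by apply/imsetS/subsetT.
  exists [set spoke i | i in S]; split=> //.
  - by apply/subsetP=> _ /imsetP[i _ ->]; apply/imsetP; exists i.
  - by rewrite card_imset //; exact: spoke_inj.
  - by rewrite spoked_del_edges /eset /= spoked_edges_split.
pose S := [set i | spoke i \in F].
have FE : F = [set spoke i | i in S].
  apply/setP=> e; apply/idP/imsetP=> [eF|[i]]; last by rewrite inE => iF ->.
  by have /imsetP[i _ E] := subsetP FM e eF; exists i; rewrite ?inE -?E.
have HS : H = spoked S.
  apply: val_inj; rewrite /= [LHS]surjective_pairing -/(vset H) -/(eset H) HV HE.
  by rewrite spoked_del_edges FE -spoked_edges_split.
exists S; split; rewrite -?HS //.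
by rewrite -F5 FE card_imset //; exact: spoke_inj.
Qed.

Lemma card_petersen_copies (good : {set 'I_n} -> bool) :
  (forall S : {set 'I_n}, #|S| = 5 -> is_subdivision petersen (spoked S) <-> good S) ->
  #|petersen_copies (spoked setT) spokes| = #|[set S : {set 'I_n} | (#|S| == 5) && good S]|.
Proof.
move=> goodP; rewrite -(card_imset _ spoked_inj); apply: eq_card => H.
rewrite inE; apply/boolp.asboolP/imsetP=> [/petersen_copyP[S [S5 subd ->]]|[S]].
  by exists S; rewrite // inE S5 eqxx; apply/goodP.
rewrite inE => /andP[/eqP S5 /(goodP _ S5) subd] ->.
by apply/petersen_copyP; exists S.
Qed.

(** Holds because edges are two-element sets, so an edge at [z] is known by its other end. *)
Lemma degree_nbrs (T : finType) (G : sgraph T) z :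
  degree G z = #|[set w | [set z; w] \in eset G]|.
Proof.
have inj : {in [set w | [set z; w] \in eset G] &, injective (fun w => [set z; w])}.
  by move=> v w _ _ /set2_eq[][] // -> ->.
rewrite /degree -(card_in_imset inj); apply: eq_card => e.
rewrite inE; apply/andP/imsetP=> [[eG ze]|[w]]; last by rewrite inE => wG ->; rewrite set21.
have /forall_inP/(_ _ eG)/andP[/cards2P[x [y [_ E]]] _] := valP G.
move: ze eG; rewrite E => /set2P[]-> eG; [exists y | exists x]; rewrite ?inE // setUC //.
Qed.

Lemma rim_subproof (g : 'I_n -> V) : injective g ->
  graph_axiom ([set g i | i : 'I_n], [set [set g i; g (ordS i)] | i : 'I_n]).
Proof.
move=> g_inj; apply/forall_inP => _ /= /imsetP[i _ ->].
rewrite cards2 (inj_eq g_inj) ordS_neq; last lia.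
by apply/subsetP=> z /set2P[]->; apply/imsetP; [exists i | exists (ordS i)].
Qed.

Definition rim (g : 'I_n -> V) (g_inj : injective g) : sgraph V := SGraph (rim_subproof g_inj).

Lemma rim_cycle (g : 'I_n -> V) (g_inj : injective g) : is_cycle (rim g_inj).
Proof.
have n0 : 0 < n by lia.
pose t := traject (@ordS n) (Ordinal n0) n.
have mem_t i : i \in t by rewrite mem_traject_ordS // gap_lt.
have next_t i : next t i = ordS i.
  apply: nextE => //; set o := Ordinal n0.
  have -> : t = o :: traject (@ordS n) (ordS o) n.-1 by rewrite -trajectS prednK.
  rewrite /cycle; have -> : rcons (traject (@ordS n) (ordS o) n.-1) o =
      traject (@ordS n) (ordS o) n.-1.+1.
    by rewrite trajectSr -iterSr prednK // iter_ordS_n.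
  exact: fpath_traject.
have t_uniq : uniq t by exact: traject_ordS_uniq.
exists (map g t); split.
- by rewrite size_map size_traject.
- by rewrite map_inj_uniq.
- apply/setP=> z; rewrite inE; apply/imsetP/mapP=> [[i _ ->]|[i _ ->]]; by exists i.
apply/setP=> e; apply/imsetP/imsetP=> [[i _ ->]|[_ /mapP[i _ ->] ->]].
  by exists (g i); [rewrite map_f | rewrite next_map // next_t].
by exists i; rewrite // next_map // next_t.
Qed.

Lemma spoked_marked : marked_permutation_graph (spoked setT) spokes.
Proof.
have inl_inj : injective (inl : 'I_n -> V) by move=> ? ? [].
have inr_inj : injective (inr : 'I_n -> V) by move=> ? ? [].
have SneP (i : 'I_n) : ordS i != ord_pred i.
  rewrite -(inj_eq (@ordS_inj n)) ord_predK; have := ltn_ord i => i_n.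
  apply/eqP => /(congr1 (@nat_of_ord n)); rewrite !ordS_val.
  by case: (ltnP i.+1 n) => ?; split_ifs; lia.
have [t pit tp] := injF_bij pi_inj.
split.
- move=> z _; rewrite degree_nbrs.
  have cards3 (a b w : V) : uniq [:: a; b; w] -> #|[set a; b; w]| = 3.
    move=> /card_uniqP /= <-; apply: eq_card => v; by rewrite !inE orbA.
  case: z => x.
    have -> : [set w | [set inl x; w] \in eset (spoked setT)] =
        [set inl (ordS x); inl (ord_pred x); inr (pi x)].
      apply/setP=> -[] w; rewrite in_set spoked_edgeE !inE /= ?in_setT ?inl_eq ?inr_eq ?orbF //.
      by rewrite /cyc_adj -[x == ordS w](can_eq (@ord_predK n)) ordSK [_ == w]eq_sym.
    by apply: cards3; rewrite /= !inE inl_eq (negPf (SneP x)).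
  have -> : [set w | [set inr x; w] \in eset (spoked setT)] =
      [set inr (ordS x); inr (ord_pred x); inl (t x)].
    apply/setP=> -[] w; rewrite in_set spoked_edgeE !inE /= ?in_setT ?inl_eq ?inr_eq ?orbF //.
      by rewrite -[w == t x](can_eq pit) tp eq_sym.
    by rewrite /cyc_adj -[x == ordS w](can_eq (@ord_predK n)) ordSK [_ == w]eq_sym.
  by apply: cards3; rewrite /= !inE inr_eq (negPf (SneP x)).
- split.
    by apply/subsetP=> _ /imsetP[i _ ->]; rewrite spoke_edge inE.
  move=> z _; apply/eqP/cards1P.
  exists (spoke (match z with inl i => i | inr i => t i end)).
  apply/setP=> e; rewrite !inE; apply/andP/eqP=> [[/imsetP[i _ ->]]|->].
    by case: z => x; rewrite !inE ?inl_eq ?inr_eq ?orbF => /eqP ->; rewrite ?tp ?pit.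
  split; first exact: imset_f.
  by case: z => x; rewrite /spoke ?tp ?set21 ?set22.
exists (rim inl_inj), (rim inr_inj); split; try exact: rim_cycle.
  split.
  - rewrite -setI_eq0; apply/eqP/setP=> z; rewrite !inE.
    by apply/negP => /andP[/imsetP[i _ ->] /imsetP[]].
  - apply/esym/eqP; rewrite -subTset; apply/subsetP=> -[] i _; rewrite inE.
      by apply/orP; left; apply/imsetP; exists i.
    by apply/orP; right; apply/imsetP; exists i.
  by rewrite spoked_del_edges /spoked_edges imset0 setU0.
move=> e; apply/andP; split; apply/negP=> /and3P[eG /subsetP eC /negP eN].
  move: eG eN eC; rewrite !inE => /orP[/orP[]|] /imsetP[i _ ->].
  - by case; apply/imsetP; exists i.
  - by move=> _ /(_ _ (set21 _ _))/imsetP[].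
  - by move=> _ /(_ _ (set22 _ _))/imsetP[].
move: eG eN eC; rewrite !inE => /orP[/orP[]|] /imsetP[i _ ->].
- by move=> _ /(_ _ (set21 _ _))/imsetP[].
- by case; apply/imsetP; exists i.
- by move=> _ /(_ _ (set21 _ _))/imsetP[].
Qed.

End Spoked.

(** * Sorted enumeration *)

Lemma sorted_enumeration n m (S : {set 'I_n}) : #|S| = m ->
  exists2 c : 'I_m -> 'I_n, {homo c : i j / i < j} & S = [set c i | i : 'I_m].
Proof.
move=> Sm; exists (fun i => enum_val (cast_ord (esym Sm) i)); last first.
  apply/setP=> x; apply/idP/imsetP=> [xS|[i _ ->]]; last exact: enum_valP.
  by exists (cast_ord Sm (enum_rank_in xS x)); rewrite ?cast_ordK ?enum_rankK_in.
have srt : sorted ltn (map val (enum S)).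
  apply: (subseq_sorted ltn_trans (s2 := map val (enum 'I_n))).
    by apply: map_subseq; rewrite {1}/enum_mem -enumT filter_subseq.
  by rewrite val_enum_ord iota_ltn_sorted.
move=> i j ij; have [i_S j_S] : i < size (enum S) /\ j < size (enum S).
  by rewrite -cardE Sm !ltn_ord.
have x0 := enum_val (cast_ord (esym Sm) i).
rewrite !(enum_val_nth x0) /=.
have := sorted_ltn_nth ltn_trans 0 srt; rewrite /prop_in2 => /(_ i j).
by rewrite !inE size_map !(nth_map x0) //; apply.
Qed.

(** * The family *)

(** [position k t a b] says that an edge of the matching joins vertex [a] of the first
    cycle to vertex [b] of the second, both counted from 0.  The label [t] tells where
    the edge comes from: the run [Rise] (0), [Fall] (1) or [Climb] (6), or one of the
    four places in the first block (2 to 5) or in the last one (7 to 10).  Labels are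
    numbered along the first cycle. *)
Inductive position (k : nat) : nat -> nat -> nat -> Prop :=
| Rise i of i < k : position k 0 (2 * i) i
| Fall i of 0 < i & i < k : position k 1 (2 * i - 1) (3 * k + 3 - 2 * i)
| First0 : position k 2 (2 * k - 1) (k + 1)
| First1 : position k 3 (2 * k) (k + 3)
| First2 : position k 4 (2 * k + 1) k
| First3 : position k 5 (2 * k + 2) (k + 2)
| Climb i of i < k : position k 6 (2 * k + 3 + i) (k + 4 + 2 * i)
| Last0 : position k 7 (3 * k + 3) (3 * k + 4)
| Last1 : position k 8 (3 * k + 4) (3 * k + 6)
| Last2 : position k 9 (3 * k + 5) (3 * k + 3)
| Last3 : position k 10 (3 * k + 6) (3 * k + 5).

(** The order in which the labels appear along the second cycle.  The runs 1 and 6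
    alternate there, which is why they share a key. *)
Definition value_key (t : nat) : nat := nth 0 [:: 0; 5; 2; 4; 1; 3; 5; 7; 9; 6; 8] t.

(** Whether an edge of label [s] can lie before an edge of label [t] on the first cycle:
    in the order of the labels, several times only in a run, and with the runs 0 and 1
    alternating. *)
Definition may_precede (s t : nat) : bool :=
  [|| s < t, (s == t) && (s \in [:: 0; 1; 6]) | (s == 1) && (t == 0)].

(** Whether [below] can be the truth value of: the edge of label [s] lies before the edge
    of label [t] on the second cycle.  It is meant for edges in this order on the first
    cycle, where the run 1 is the decreasing one. *)
Definition may_be_below (s t : nat) (below : bool) : bool :=
  if s == t then (if s == 1 then ~~ below else below)
  else if value_key s < value_key t then below
  else if value_key t < value_key s then ~~ below else true.

(** Five edges are encoded in the order of the first cycle, each one by its label and by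
    its rank from 0 to 4 on the second cycle. *)
Definition compatible (u v : nat * nat) : bool :=
  [&& may_precede u.1 v.1, u.2 != v.2 & may_be_below u.1 v.1 (u.2 < v.2)].

Definition no_common_edge (w : seq (nat * nat)) : bool :=
  let r := unzip2 w in
  all (fun i => let a := nth 0 r i in let b := nth 0 r (i.+1 %% 5) in
         (b != a.+1 %% 5) && (a != b.+1 %% 5)) (iota 0 5).

Definition has_block (w : seq (nat * nat)) : bool :=
  all (mem (unzip1 w)) (iota 2 4) || all (mem (unzip1 w)) (iota 7 4).

(** Tries all extensions of [w] by [m] elements; [L] is cut down to what remains
    compatible with the elements chosen so far, which keeps the search small. *)
Fixpoint search (L : seq (nat * nat)) (m : nat) (w : seq (nat * nat)) : bool :=
  if m is m'.+1 then
    all (fun u => search [seq v <- L | compatible u v] m' (rcons w u)) L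
  else no_common_edge w == has_block w.

Lemma searchP L w w' :
  search L (size w') w -> all (mem L) w' -> pairwise compatible w' ->
  no_common_edge (w ++ w') = has_block (w ++ w').
Proof.
elim: w' L w => [|u w' IH] L w /=; first by rewrite cats0 => /eqP.
move=> /allP sw /andP[/sw wu /allP w'L] /andP[/allP uw' cw']; rewrite -cat_rcons.
apply: IH wu _ cw'; apply/allP=> v vw'.
by rewrite /= mem_filter uw' //; exact: w'L.
Qed.

Definition labels : seq (nat * nat) := [seq (t, r) | t <- iota 0 11, r <- iota 0 5].

Lemma search_labels : search labels 5 [::].
Proof. by vm_compute. Qed.

Section Family.
Variable k : nat.
Hypothesis k_gt0 : 0 < k.

Lemma position_exists a : a < 3 * k + 7 -> exists t b, position k t a b.
Proof.
move=> an.
have [lt1|ge1] := ltnP a (2 * k - 1).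
  have [even_a|odd_a] : a = 2 * (a./2) \/ a = 2 * (a./2) + 1.
    by have := odd_double_half a; rewrite -muln2; case: (odd a) => /=; lia.
    by exists 0, (a./2); rewrite {1}even_a; constructor; lia.
  exists 1, (3 * k + 3 - 2 * (a./2).+1).
  have {1}-> : a = 2 * (a./2).+1 - 1 by lia.
  by constructor; lia.
have [lt2|ge2] := ltnP a (2 * k + 3).
  have : a = 2 * k - 1 \/ a = 2 * k \/ a = 2 * k + 1 \/ a = 2 * k + 2 by lia.
  by case=> [->|[->|[->|->]]]; do 2!eexists; constructor.
have [lt3|ge3] := ltnP a (3 * k + 3).
  exists 6, (k + 4 + 2 * (a - (2 * k + 3))).
  have {1}-> : a = 2 * k + 3 + (a - (2 * k + 3)) by lia.
  by constructor; lia.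
have : a = 3 * k + 3 \/ a = 3 * k + 4 \/ a = 3 * k + 5 \/ a = 3 * k + 6 by lia.
by case=> [->|[->|[->|->]]]; do 2!eexists; constructor.
Qed.

Lemma position_bounds t a b : position k t a b -> (t < 11) && (b < 3 * k + 7).
Proof. by case=> *; lia. Qed.

Lemma position_edge a b :
  (a.+1, b.+1) \in E1 k ++ E2 k ++ E3 k <-> exists t, position k t a b.
Proof.
rewrite /E1 /E2 /E3 !mem_cat; split.
  case/orP=> [/orP[]|/orP[]].
  - move=> /mapP[i]; rewrite mem_iota => i_k [ea eb].
    exists 0; have -> : a = 2 * b by lia.
    by constructor; lia.
  - move=> /mapP[i]; rewrite mem_iota => i_k [ea eb].
    exists 6; have [-> ->] : a = 2 * k + 3 + (i - 1) /\ b = k + 4 + 2 * (i - 1) by lia.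
    by constructor; lia.
  - move=> /mapP[i]; rewrite mem_iota => i_k [ea eb].
    exists 1; have [-> ->] : a = 2 * i - 1 /\ b = 3 * k + 3 - 2 * i by lia.
    by constructor; lia.
  rewrite !inE !xpair_eqE.
  do 7?[case/orP]; case/andP=> /eqP ea /eqP eb.
  - have [-> ->] : a = 2 * k - 1 /\ b = k + 1 by lia. by eexists; constructor.
  - have [-> ->] : a = 2 * k /\ b = k + 3 by lia. by eexists; constructor.
  - have [-> ->] : a = 2 * k + 1 /\ b = k by lia. by eexists; constructor.
  - have [-> ->] : a = 2 * k + 2 /\ b = k + 2 by lia. by eexists; constructor.
  - have [-> ->] : a = 3 * k + 3 /\ b = 3 * k + 4 by lia. by eexists; constructor.
  - have [-> ->] : a = 3 * k + 4 /\ b = 3 * k + 6 by lia. by eexists; constructor.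
  - have [-> ->] : a = 3 * k + 5 /\ b = 3 * k + 3 by lia. by eexists; constructor.
  - have [-> ->] : a = 3 * k + 6 /\ b = 3 * k + 5 by lia. by eexists; constructor.
case=> t; case=> [i ?|i ? ?|||||i ?||||]; rewrite ?inE ?xpair_eqE.
- apply/orP; left; apply/orP; left; apply/mapP; exists i.+1; first by rewrite mem_iota; lia.
  by congr pair; lia.
- apply/orP; right; apply/orP; left; apply/mapP; exists i; first by rewrite mem_iota; lia.
  by congr pair; lia.
1-4: by lia.
- apply/orP; left; apply/orP; right; apply/mapP; exists i.+1; first by rewrite mem_iota; lia.
  by congr pair; lia.
all: by lia.
Qed.

(** The linear inequalities behind the tables [may_precede] and [may_be_below]. *)
Lemma position_order t a b t' a' b' :
  position k t a b -> position k t' a' b' -> a < a' ->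
  [&& may_precede t t', b != b' & may_be_below t t' (b < b')].
Proof.
by case=> [i ?|i ? ?|||||i ?||||]; case=> [j ?|j ? ?|||||j ?||||] ?;
  rewrite /may_precede /may_be_below /= ?andbT ?andbF; lia.
Qed.

Lemma position_inj t a b t' a' b' :
  position k t a b -> position k t' a' b' -> a = a' -> t = t' /\ b = b'.
Proof. by case=> [i ?|i ? ?|||||i ?||||]; case=> [j ?|j ? ?|||||j ?||||] ?; lia. Qed.

Lemma position_special t a b :
  position k t a b ->
  (forall r, r < 4 -> (t == 2 + r) = (a == 2 * k - 1 + r)) /\
  (forall r, r < 4 -> (t == 7 + r) = (a == 3 * k + 3 + r)).
Proof. by case=> [i ?|i ? ?|||||i ?||||]; split=> r ?; lia. Qed.

End Family.

(** * Counting *)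

Lemma card_block n lo m :
  lo + m <= n -> #|[set i : 'I_n | lo <= i < lo + m]| = m.
Proof.
move=> lmn; have lt_n (j : 'I_m) : lo + j < n by have := ltn_ord j; lia.
have shift_inj : injective (fun j => Ordinal (lt_n j)).
  by move=> i j [] /addnI/val_inj.
rewrite -[RHS]card_ord -(card_imset _ shift_inj); apply: eq_card => i.
rewrite inE; apply/idP/imsetP=> [i_m|[j _ ->] /=]; last by have := ltn_ord j; lia.
have jm : i - lo < m by lia.
by exists (Ordinal jm) => //; apply: val_inj => /=; lia.
Qed.

Lemma card_supersets1 (T : finType) (X : {set T}) :
  #|[set S : {set T} | (#|S| == #|X|.+1) && (X \subset S)]| = #|T| - #|X|.
Proof.
have -> : #|T| - #|X| = #|~: X| by rewrite -(cardsC X) addKn.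
have inj : {in ~: X &, injective (fun x => x |: X)}.
  move=> x y; rewrite !inE => xX yX E.
  by have := setU11 x X; rewrite E !inE (negPf xX) orbF => /eqP.
rewrite -(card_in_imset inj); apply: eq_card => S; rewrite inE.
apply/andP/imsetP=> [[/eqP S1 XS]|[x]]; last first.
  by rewrite inE => xX ->; rewrite cardsU1 xX subsetUr.
have /cards1P[x Ex] : #|S :\: X| == 1 by rewrite cardsD (setIidPr XS) S1; lia.
have : x \in S :\: X by rewrite Ex set11.
rewrite inE => /andP[xX xS]; exists x; rewrite ?inE //.
by rewrite -(setID S X) (setIidPr XS) Ex setUC.
Qed.

Section Count.
Variable k : nat.
Hypothesis k_gt0 : 0 < k.
Local Notation n := (ncyc k).
Variable pi : 'I_n -> 'I_n.
Hypothesis piP : forall i : 'I_n, exists t, position k t i (pi i).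

Lemma position_perm_inj : injective pi.
Proof.
move=> i j E; have [t ti] := piP i; have [t' tj] := piP j.
apply: val_inj; case: (ltngtP i j) => // ij.
  by have /and3P[_] := position_order k_gt0 ti tj ij; rewrite E eqxx.
by have /and3P[_] := position_order k_gt0 tj ti ij; rewrite E eqxx.
Qed.

Lemma matching_edgeE (i j : 'I_n) :
  ((i.+1, j.+1) \in E1 k ++ E2 k ++ E3 k) = (j == pi i) :> bool.
Proof.
have [t ti] := piP i.
apply/idP/eqP=> [/position_edge -/(_ k_gt0)[t' tj]|->].
  by apply: val_inj; case: (position_inj k_gt0 tj ti).
by apply/position_edge => //; exists t.
Qed.

Lemma Mk_spokes : Mk k = spokes pi.
Proof.
apply/setP=> e; apply/imsetP/imsetP=> [[[i j]]|[i _ ->]].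
  by rewrite inE /= matching_edgeE => /eqP-> ->; exists i.
by exists (i, pi i); rewrite // inE matching_edgeE.
Qed.

Let n_gt2 : 2 < n. Proof. by rewrite /ncyc addnC. Qed.

Lemma Gk_spoked : Gk k = spoked pi n_gt2 setT.
Proof.
apply: val_inj; congr pair; rewrite /= /Gk_edges /spoked_edges Mk_spokes; congr (_ :|: _).
by apply/setP=> e; apply/imsetP/imsetP=> -[i _ ->]; exists i.
Qed.

Definition block (lo : nat) : {set 'I_n} := [set i : 'I_n | lo <= i < lo + 4].

Definition has_full_block (S : {set 'I_n}) : bool :=
  (block (2 * k - 1) \subset S) || (block (3 * k + 3) \subset S).

(** The labels of a block belong to one edge each, so the word contains all of them
    exactly when the five edges contain the block. *)
Lemma block_labels (c : 'I_5 -> 'I_n) (t : 'I_5 -> nat) S lo t0 :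
  S = [set c i | i : 'I_5] -> lo + 4 <= n ->
  (forall i r, r < 4 -> (t i == t0 + r) = (c i == lo + r :> nat)) ->
  all (mem (codom t)) (iota t0 4) = (block lo \subset S).
Proof.
move=> -> lon tc; apply/allP/subsetP=> [h x|h r].
  rewrite inE => xlo; have := h (t0 + (x - lo)); rewrite mem_iota => /(_ _)/codomP[|i E].
    by lia.
  apply/imsetP; exists i => //; apply: val_inj; apply/eqP; rewrite eq_sym /=.
  have -> : (x : nat) = lo + (x - lo) by lia.
  by rewrite -tc ?E //; lia.
rewrite mem_iota => rt; have xn : lo + (r - t0) < n by lia.
have /imsetP[i _ E] : Ordinal xn \in [set c i | i : 'I_5] by apply: h; rewrite inE /=; lia.
apply/codomP; exists i; apply/esym/eqP.
have -> : r = t0 + (r - t0) by lia.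
by rewrite tc -?E //=; lia.
Qed.

Lemma codom5 (A : Type) (g : 'I_5 -> A) :
  codom g = [seq g (inord a) | a <- iota 0 5].
Proof.
rewrite /codom /image_mem -[iota 0 5]val_enum_ord -map_comp.
by apply: eq_map => i /=; rewrite inord_val.
Qed.

(** Both sides are read off the word of labels and ranks of the five edges, to which the
    exhaustive search applies. *)
Lemma copy_blocks (S : {set 'I_n}) : #|S| = 5 ->
  is_subdivision petersen (spoked pi n_gt2 S) <-> has_full_block S.
Proof.
move=> S5; have [c c_inc cS] := sorted_enumeration S5.
have [d d_inc dS] : exists2 d : 'I_5 -> 'I_n, {homo d : i j / i < j} &
    [set pi i | i in S] = [set d i | i : 'I_5].
  by apply: sorted_enumeration; rewrite card_imset //; exact: position_perm_inj.
have cP := increasing_cyclic_order c_inc; have dP := increasing_cyclic_order d_inc.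
have [c_inj _ _] := cP; have [d_inj _ _] := dP.
have [s cds] : exists s : 'I_5 -> 'I_5, forall i, pi (c i) = d (s i).
  apply: (@fin_all_exists _ (fun _ => _) (fun i j => pi (c i) = d j)) => i.
  have /imsetP[j _ ->] : pi (c i) \in [set d i | i : 'I_5]; last by exists j.
  by rewrite -dS cS imset_f ?imset_f.
have s_inj : injective s.
  by move=> i j E; apply/c_inj/position_perm_inj; rewrite !cds E.
have [t tP] : exists t : 'I_5 -> nat, forall i, position k (t i) (c i) (pi (c i)).
  exact: (@fin_all_exists _ (fun _ => _) (fun i t => position k t (c i) (pi (c i)))).
have d_lt i j : (d i < d j) = (i < j).
  by case: (ltngtP i j) => [/d_inc|/d_inc|/val_inj->]; lia.
have compat (i j : 'I_5) : i < j -> compatible (t i, s i : nat) (t j, s j : nat).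
  move=> ij; have := position_order k_gt0 (tP i) (tP j) (c_inc _ _ ij).
  by rewrite !cds d_lt /compatible /= !val_eqE (inj_eq d_inj).
pose w := [seq (t (inord a), s (inord a) : nat) | a <- iota 0 5].
have w1 : unzip1 w = [seq t (inord a) | a <- iota 0 5] by rewrite /unzip1 -map_comp.
have w2 a : a < 5 -> nth 0 (unzip2 w) a = s (inord a).
  by move=> a5; rewrite /unzip2 -map_comp (nth_map 0) ?size_iota // nth_iota.
have /(_ [::] w) := @searchP labels; rewrite size_map size_iota search_labels cat0s => search_w.
have w_star : no_common_edge w = has_block w.
  apply: search_w => //.
    apply/allP=> _ /mapP[a _ ->]; rewrite /= allpairs_f // mem_iota //=.
    by case/andP: (position_bounds k_gt0 (tP (inord a))).
  by rewrite /w /= !compat //= !inordK.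
have -> : has_full_block S = has_block w.
  rewrite /has_full_block /has_block w1 -codom5; congr (_ || _); apply/esym.
    apply: (block_labels cS) => [|i r r4]; first by rewrite /ncyc; lia.
    by case: (position_special k_gt0 (tP i)) => -> .
  apply: (block_labels cS) => [|i r r4]; first by rewrite /ncyc; lia.
  by case: (position_special k_gt0 (tP i)) => _ ->.
rewrite -w_star.
have starE i : ~~ cyc_adj (s i) (s (ordS i)) =
    (nth 0 (unzip2 w) (i.+1 %% 5) != (nth 0 (unzip2 w) i).+1 %% 5) &&
    (nth 0 (unzip2 w) i != (nth 0 (unzip2 w) (i.+1 %% 5)).+1 %% 5).
  by rewrite !w2 ?ltn_pmod // inord_val -[i.+1 %% 5]/(val (ordS i)) inord_val negb_or.
have starP := subdivisionP n_gt2 cP dP s_inj cS cds.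
split=> [/starP star|/allP star].
  apply/allP=> a; rewrite mem_iota /= add0n => a5.
  by have := starE (Ordinal a5); rewrite star ?cyc_adj_ordS // => /esym.
apply/starP => i j; wlog -> : i j / j = ordS i => [H|_].
  case/orP=> /eqP E; first by apply: H; rewrite ?E ?cyc_adj_ordS.
  by rewrite cyc_adjC; apply: H; rewrite ?E ?cyc_adj_ordS.
by rewrite starE; apply: star; rewrite mem_iota add0n ltn_ord.
Qed.

(** A set of five indices contains at most one of the two disjoint blocks, and each block
    has [3 * k + 7 - 4] supersets with one more element. *)
Lemma card_full_blocks :
  #|[set S : {set 'I_n} | (#|S| == 5) && has_full_block S]| = 6 * k + 6.
Proof.
have b1 : #|block (2 * k - 1)| = 4 by apply: card_block; rewrite /ncyc; lia.
have b2 : #|block (3 * k + 3)| = 4 by apply: card_block; rewrite /ncyc; lia.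
have := card_supersets1 (block (2 * k - 1)); have := card_supersets1 (block (3 * k + 3)).
rewrite b1 b2 card_ord => c2 c1.
set A := [set S | _] in c1; set B := [set S | _] in c2.
have -> : [set S : {set 'I_n} | (#|S| == 5) && has_full_block S] = A :|: B.
  by apply/setP=> S; rewrite !inE andb_orr.
have AB : A :&: B = set0.
  apply/setP=> S; rewrite !inE; apply/negP=> /andP[/andP[/eqP S5 h1] /andP[_ h2]].
  have : block (2 * k - 1) :|: block (3 * k + 3) \subset S by rewrite subUset h1.
  move/subset_leq_card; rewrite cardsU b1 b2 S5.
  have -> : block (2 * k - 1) :&: block (3 * k + 3) = set0.
    by apply/setP=> x; rewrite !inE; lia.
  by rewrite cards0.
by rewrite cardsU AB cards0 c1 c2 /ncyc; lia.
Qed.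

End Count.

Lemma position_perm_exists k : 0 < k ->
  exists pi : 'I_(ncyc k) -> 'I_(ncyc k), forall i : 'I_(ncyc k), exists t, position k t i (pi i).
Proof.
move=> k_gt0.
apply: (@fin_all_exists _ (fun _ => _) (fun i j : 'I_(ncyc k) => exists t, position k t i j)) => i.
have [t [b ib]] := position_exists k_gt0 (ltn_ord i).
have /andP[_ bn] := position_bounds k_gt0 ib.
by exists (Ordinal bn), t.
Qed.

Theorem proposition10 (k : nat) (hk : 1 <= k) :
  marked_permutation_graph (Gk k) (Mk k) /\
  #|petersen_copies (Gk k) (Mk k)| = 6 * k + 6.
Proof.
have [pi piP] := position_perm_exists hk.
have pi_inj := position_perm_inj hk piP.
rewrite (Gk_spoked hk piP) (Mk_spokes hk piP); split; first exact: spoked_marked.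
rewrite (card_petersen_copies (copy_blocks hk piP)).
exact: card_full_blocks.
Qed.
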